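(* Let $(A,M)$ be a commutative local ring with maximal ideal $M$, and let $R = A \propto A/M$ be the trivial ring extension of $A$ by its residue field $A/M$. Then: (1) If $M$ is not finitely generated, then $R$ is a $(3,0)$-ring, i.e., every $3$-presented $R$-module is projective. (2) If $M$ contains a regular element (a non-zero-divisor of $A$), then $R$ is not a $(2,d)$-ring for any integer $d \geq 0$.
   Context: All rings are commutative with identity and all modules are unital. For a nonnegative integer $n$, an $R$-module $E$ is $n$-presented if there is an exact sequence $F_n \to F_{n-1} \to \cdots \to F_0 \to E \to 0$ in which each $F_i$ is a finitely generated free $R$-module. For nonnegative integers $n,d$, a ring $R$ is an $(n,d)$-ring if every $n$-presented $R$-module has projective dimension at most $d$. For a ring $A$ and an $A$-module $E$, the trivial ring extension $A \propto E$ is the ring with underlying additive group $A \times E$ and multiplication $(a,e)(a',e') = (aa', ae' + a'e)$. *)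

(* Defs.v *)
From HB Require Import structures.
From mathcomp Require Import all_boot all_order all_algebra.
From mathcomp Require Import ring_quotient generic_quotient.
Set Implicit Arguments. Unset Strict Implicit. Unset Printing Implicit Defensive.
Import GRing.Theory.
Local Open Scope ring_scope.
Local Open Scope quotient_scope.

(* A (commutative, nonzero) local ring: the non-units form an ideal,
   equivalently they are closed under addition. *)
HB.mixin Record ComUnitRing_isLocal R of GRing.ComUnitRing R := {
  nonunitD : forall x y : R,
    x \isn't a GRing.unit -> y \isn't a GRing.unit -> x + y \isn't a GRing.unit
}.
#[short(type="localRingType")]
HB.structure Definition LocalRing := {R of ComUnitRing_isLocal R & GRing.ComUnitRing R}.

Definition maxideal (A : localRingType) : A -> bool := fun x => x \isn't a GRing.unit.
Arguments maxideal : clear implicits.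

Lemma maxideal_idealr_closed (A : localRingType) : idealr_closed (maxideal A).
Proof.
split; first by rewrite unfold_in /maxideal /= unitr0.
  by rewrite unfold_in /maxideal /= unitr1.
move=> a u v; rewrite !unfold_in /maxideal /= => Hu Hv.
apply: nonunitD => //; rewrite unitrM negb_and; apply/orP; right; exact: Hu.
Qed.

HB.instance Definition _ (A : localRingType) :=
  isIdealr.Build A (maxideal A) (maxideal_idealr_closed A).

Definition residue (A : localRingType) := {ideal_quot (maxideal A : idealr A)}.
HB.instance Definition _ (A : localRingType) := GRing.ComNzRing.on (residue A).

Definition residue_scale (A : localRingType) (a : A) (x : residue A) : residue A :=
  (\pi_(residue A) a) * x.

Lemma residue_scalerA (A : localRingType) a b (v : residue A) :
  residue_scale a (residue_scale b v) = residue_scale (a * b) v.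
Proof. by rewrite /residue_scale mulrA -rmorphM. Qed.

Lemma residue_scale1r (A : localRingType) : left_id 1 (@residue_scale A).
Proof. by move=> v; rewrite /residue_scale rmorph1 mul1r. Qed.

Lemma residue_scalerDr (A : localRingType) : right_distributive (@residue_scale A) +%R.
Proof. by move=> a u v; rewrite /residue_scale mulrDr. Qed.

Lemma residue_scalerDl (A : localRingType) (v : residue A) :
  {morph (@residue_scale A)^~ v : a b / a + b}.
Proof. by move=> a b; rewrite /residue_scale rmorphD mulrDl. Qed.

HB.instance Definition _ (A : localRingType) :=
  GRing.Zmodule_isLmodule.Build A (residue A)
    (@residue_scalerA A) (@residue_scale1r A) (@residue_scalerDr A) (@residue_scalerDl A).

Definition triv_ext (A : comNzRingType) (E : lmodType A) : Type := (A * E)%type.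
Arguments triv_ext : clear implicits.
HB.instance Definition _ (A : comNzRingType) (E : lmodType A) :=
  GRing.Zmodule.on (triv_ext A E).

Definition triv_one (A : comNzRingType) (E : lmodType A) : triv_ext A E := (1, 0).
Definition triv_mul (A : comNzRingType) (E : lmodType A) (x y : triv_ext A E) :
  triv_ext A E := (x.1 * y.1, x.1 *: y.2 + y.1 *: x.2).

Lemma triv_mulA (A : comNzRingType) (E : lmodType A) : associative (@triv_mul A E).
Proof.
move=> [a e] [b f] [c g]; rewrite /triv_mul /=; congr (_, _); first by rewrite mulrA.
rewrite !scalerDr !scalerA addrA; congr (_ + _ + _).
by rewrite mulrC.
by rewrite [c * b]mulrC.
Qed.

Lemma triv_mulC (A : comNzRingType) (E : lmodType A) : commutative (@triv_mul A E).
Proof. by move=> [a e] [b f]; rewrite /triv_mul /= mulrC addrC. Qed.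

Lemma triv_mul1 (A : comNzRingType) (E : lmodType A) :
  left_id (@triv_one A E) (@triv_mul A E).
Proof. by move=> [a e]; rewrite /triv_mul /triv_one /= mul1r scale1r scaler0 addr0. Qed.

Lemma triv_mulDl (A : comNzRingType) (E : lmodType A) :
  left_distributive (@triv_mul A E) +%R.
Proof.
move=> [a e] [b f] [c g]; rewrite /triv_mul /=; congr (_, _); first by rewrite mulrDl.
by rewrite scalerDl scalerDr addrACA.
Qed.

Lemma triv_one_neq0 (A : comNzRingType) (E : lmodType A) : @triv_one A E != 0.
Proof. by apply/eqP => -[] /eqP; rewrite oner_eq0. Qed.

HB.instance Definition _ (A : comNzRingType) (E : lmodType A) :=
  GRing.Zmodule_isComNzRing.Build (triv_ext A E)
    (@triv_mulA A E) (@triv_mulC A E) (@triv_mul1 A E) (@triv_mulDl A E)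
    (@triv_one_neq0 A E).

Definition is_projective (R : pzRingType) (P : lmodType R) : Prop :=
  forall (V W : lmodType R) (h : {linear V -> W}) (f : {linear P -> W}),
    (forall w, exists v, h v = w) ->
    exists g : {linear P -> V}, forall p, h (g p) = f p.

(* E is n-presented: there is an exact sequence
     F_n --f_(n-1)--> F_(n-1) -> ... --f_0--> F_0 --p--> E --> 0
   with F_i = R^(k i) finitely generated free (row vectors), f_i : F_(i+1) -> F_i
   given by right multiplication by a matrix. *)
Definition n_presented (R : pzRingType) (E : lmodType R) (n : nat) : Prop :=
  exists (k : nat -> nat) (f : forall i : nat, 'M[R]_(k i.+1, k i))
         (p : {linear 'rV[R]_(k 0) -> E}),
    (forall e, exists x, p x = e) /\
    ((0 < n)%N -> forall x, p x = 0 <-> exists y : 'rV[R]_(k 1), x = y *m f 0) /\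
    (forall i : nat, (i.+1 < n)%N -> forall x : 'rV[R]_(k i.+1),
        x *m f i = 0 <-> exists y : 'rV[R]_(k i.+2), x = y *m f i.+1).

(* E has projective dimension at most d: there is an exact sequence
     ... -> P_(i+1) --g_i--> P_i -> ... -> P_0 --q--> E --> 0
   with every P_i projective and P_i = 0 for i > d. *)
Definition pd_le (R : pzRingType) (E : lmodType R) (d : nat) : Prop :=
  exists (P : nat -> lmodType R) (g : forall i : nat, {linear P i.+1 -> P i})
         (q : {linear P 0 -> E}),
    (forall i, is_projective (P i)) /\
    (forall i, (d < i)%N -> forall x : P i, x = 0) /\
    (forall e, exists x, q x = e) /\
    (forall x, q x = 0 <-> exists y, x = g 0 y) /\
    (forall i (x : P i.+1), g i x = 0 <-> exists y, x = g i.+1 y).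

Definition nd_ring (R : pzRingType) (n d : nat) : Prop :=
  forall E : lmodType R, n_presented E n -> pd_le E d.

Definition fg_ideal (A : comNzRingType) (I : {pred A}) : Prop :=
  exists (n : nat) (s : 'I_n -> A),
    forall x, x \in I <-> exists c : 'I_n -> A, x = \sum_(i < n) c i * s i.

Definition regular (A : comNzRingType) (m : A) : Prop :=
  forall a, m * a = 0 -> a = 0.

(* Main.v *)
(** Let R = A ∝ k with k = A/M, N = M ∝ k its maximal ideal, phi : R -> k the
residue map, psi : R -> k the second projection, a phi-derivation, and
s = (0, 1), so that s N = 0.

(1) Let F3 -> F2 -> F1 -> F0 -> E -> 0 be exact. If some v in F1 maps into N F0
but is not in im(F2 -> F1) + N F1, choose a functional c on F1/N F1 that kills
im(F2 -> F1) and sends v to 1. As s v is a cycle, it is the image of some y in F2.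
Composing psi with c and F2 -> F1 gives an R-linear map F2 -> k, because psi is
a derivation and c kills the image; it sends y to psi(s) = 1 and vanishes on the
finitely generated module ker(F2 -> F1). Since N y lies in that kernel, lifting
the map to F2 -> R shows that N is finitely generated. So if M is not finitely
generated, Tor_1(E, k) = 0 and E is projective.

(2) Let t = (m, 1) and E = R/Rt. As Ann t = Rs, E is 2-presented. In a projective
resolution (P_i) of E choose x_0 over 1, g_0 x_1 = t x_0 and g_i x_(i+1) = s x_i.
Starting from a lift l_0 : P_0 -> R of E -> k, let l_(i+1) : P_(i+1) -> R lift the
map psi l_i g_i : P_(i+1) -> k, which is linear because phi l_i g_i = 0. As
psi(t) = psi(s) = 1, phi(l_i x_i) = 1 for all i, so no P_i is zero. *)
Require Import Defs.
From HB Require Import structures.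
From mathcomp Require Import all_boot all_order all_algebra.
From mathcomp Require Import ring_quotient generic_quotient.
From mathcomp Require Import boolp.
Set Implicit Arguments. Unset Strict Implicit. Unset Printing Implicit Defensive.
Import GRing.Theory.
Local Open Scope ring_scope.
Local Open Scope quotient_scope.

(** * Linear maps and restriction of scalars *)

Lemma linear_witness (R : pzRingType) (U V : lmodType R) (f : U -> V) :
  linear f -> exists g : {linear U -> V}, g =1 f.
Proof.
move=> lin_f.
pose g : {linear U -> V} := HB.pack f (GRing.isLinear.Build R U V *:%R f lin_f).
by exists g.
Qed.

(** Makes k an R-module through the residue map, and R/Rt one through the quotient map. *)
Definition scalars_via (R S : pzRingType) (phi : {rmorphism R -> S}) : Type := S.
HB.instance Definition _ (R S : pzRingType) (phi : {rmorphism R -> S}) :=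
  GRing.Zmodule.on (scalars_via phi).

Section ScalarsVia.
Variables (R S : pzRingType) (phi : {rmorphism R -> S}).

Definition via_scale (a : R) (x : scalars_via phi) : scalars_via phi :=
  (phi a : S) * (x : S).

Lemma via_scalerA a b (v : scalars_via phi) :
  via_scale a (via_scale b v) = via_scale (a * b) v.
Proof. by rewrite /via_scale rmorphM mulrA. Qed.

Lemma via_scale1r : left_id 1 via_scale.
Proof. by move=> v; rewrite /via_scale rmorph1 mul1r. Qed.

Lemma via_scalerDr : right_distributive via_scale +%R.
Proof. by move=> a u v; apply: mulrDr. Qed.

Lemma via_scalerDl (v : scalars_via phi) :
  {morph via_scale^~ v : a b / a + b}.
Proof. by move=> a b; rewrite /via_scale rmorphD; apply: mulrDl. Qed.

HB.instance Definition _ :=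
  GRing.Zmodule_isLmodule.Build R (scalars_via phi)
    via_scalerA via_scale1r via_scalerDr via_scalerDl.

Lemma via_scaleE (a : R) (x : scalars_via phi) :
  a *: x = (phi a : S) * (x : S) :> S.
Proof. by []. Qed.

Lemma via_linear : linear (phi : R^o -> scalars_via phi).
Proof. by move=> a x y; rewrite rmorphD rmorphM. Qed.

End ScalarsVia.

Lemma via_factor (R S T : pzRingType) (pi : {rmorphism R -> S})
    (phi : {rmorphism R -> T}) :
  (forall x, exists r, pi r = x) -> (forall r, pi r = 0 -> phi r = 0) ->
  exists l : {linear scalars_via pi -> scalars_via phi}, forall r, l (pi r) = phi r.
Proof.
move=> pi_surj ker_le.
have sig (x : S) : {r | pi r == x} by apply: sigW; have [r <-] := pi_surj x; exists r.
pose f (x : scalars_via pi) : scalars_via phi := phi (sval (sig x)).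
have fE r : f (pi r) = phi r.
  rewrite /f; case: (sig (pi r)) => r' /= /eqP r'E.
  by apply/eqP; rewrite -subr_eq0 -rmorphB ker_le // rmorphB r'E subrr.
have [l lE] : exists l : {linear scalars_via pi -> scalars_via phi}, l =1 f.
  apply: linear_witness => a x y.
  have [r <-] := pi_surj x; have [r' <-] := pi_surj y.
  have -> : a *: (pi r : scalars_via pi) + pi r' = pi (a * r + r').
    by rewrite rmorphD rmorphM.
  by rewrite !fE rmorphD rmorphM.
by exists l => r; rewrite lE fE.
Qed.

(** * Projective modules and split presentations *)

Lemma trivial_projective (R : pzRingType) (P : lmodType R) :
  (forall x : P, x = 0) -> is_projective P.
Proof.
by move=> P0 V W h f _; exists \0 => p; rewrite /= (P0 p) !linear0.
Qed.

Lemma projective_pd_le0 (R : nzRingType) (E : lmodType R) :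
  is_projective E -> pd_le E 0.
Proof.
move=> projE.
pose P i : lmodType R := if i is 0 then E else 'rV[R]_0.
have P0 i : (0 < i)%N -> forall x : P i, x = 0.
  by case: i => // i _ x; apply/rowP => -[].
exists P, (fun i => \0 : {linear P i.+1 -> P i}), (idfun : {linear E -> E}).
split; first by case=> [|i] //; apply: trivial_projective; apply: P0.
split; first exact: P0.
split; first by move=> e; exists e.
split=> [x|i x].
  by split=> [/= ->|[y ->]] //; exists 0.
by split=> // _; exists 0; apply: P0.
Qed.

Section Coker.
Variables (R : comNzRingType) (E : lmodType R) (m n : nat).
Variables (f : 'M[R]_(m, n)) (p : {linear 'rV[R]_n -> E}).
Hypothesis p_surj : forall e, exists x, p x = e.
Hypothesis p_ker : forall x, p x = 0 <-> exists y : 'rV[R]_m, x = y *m f.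

(** [g *m f] is an idempotent projecting the free module onto the image of [f], so [1%:M - g *m f]
    kills the kernel of [p] and induces a section of [p]. *)
Lemma regular_coker_projective (g : 'M[R]_(n, m)) :
  f *m g *m f = f -> is_projective E.
Proof.
move=> fgf V W h l h_surj.
have [v hv] : exists v : 'I_n -> V, forall i, h (v i) = l (p (delta_mx 0 i)).
  apply: (@fin_all_exists _ (fun=> V : Type) (fun i w => h w = l (p (delta_mx 0 i)))).
  by move=> i; apply: h_surj.
pose lift (x : 'rV[R]_n) := \sum_i x 0 i *: v i.
have lift_lin a x y : lift (a *: x + y) = a *: lift x + lift y.
  rewrite /lift scaler_sumr -big_split; apply: eq_bigr => i _.
  by rewrite !mxE scalerDl scalerA.
have h_lift x : h (lift x) = l (p x).
  rewrite {2}(row_sum_delta x) !linear_sum; apply: eq_bigr => i _.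
  by rewrite !linearZ /= hv.
have sig e : {x | p x == e} by apply: sigW; have [x <-] := p_surj e; exists x.
pose sec e := sval (sig e) *m (1%:M - g *m f).
have secE x : sec (p x) = x *m (1%:M - g *m f).
  rewrite /sec; case: (sig (p x)) => x' /= /eqP px'.
  have /p_ker[y xy] : p (x' - x) = 0 by rewrite linearB /= px' subrr.
  apply/eqP; rewrite -subr_eq0 -mulmxBl xy mulmxBr mulmx1.
  by rewrite mulmxA -(mulmxA y) -mulmxA fgf subrr.
have [s sE] : exists s : {linear E -> V}, s =1 (fun e => lift (sec e)).
  apply: linear_witness => a e1 e2.
  have [x1 <-] := p_surj e1; have [x2 <-] := p_surj e2.
  by rewrite -linearP !secE mulmxDl -scalemxAl lift_lin.
exists s => e; have [x <-] := p_surj e.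
rewrite sE h_lift secE mulmxBr mulmx1 linearB /= [p (x *m _)](_ : _ = 0) ?subr0 //.
by apply/p_ker; exists (x *m g); rewrite mulmxA.
Qed.
End Coker.

(** * Local rings with a derivation into the residue field *)

Section ResidueField.
Variables (R : comNzRingType) (k : fieldType) (phi : {rmorphism R -> k}).
Hypothesis phi_surj : forall x, exists r, phi r = x.
Hypothesis phi_inv : forall r, phi r != 0 -> exists r', r' * r = 1.

Lemma lift_mx m n (B : 'M[k]_(m, n)) : exists C : 'M[R]_(m, n), map_mx phi C = B.
Proof.
have [F FE] : exists F : 'I_m * 'I_n -> R, forall ij, phi (F ij) = B ij.1 ij.2.
  apply: (@fin_all_exists _ (fun=> R : Type) (fun ij r => phi r = B ij.1 ij.2)).
  by move=> ij; apply: phi_surj.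
by exists (\matrix_(i, j) F (i, j)); apply/matrixP => i j; rewrite !mxE FE.
Qed.

Lemma local_invertible n (X : 'M[R]_n) :
  map_mx phi X \in unitmx -> exists Y, Y *m X = 1%:M.
Proof.
rewrite unitmxE det_map_mx unitfE => /phi_inv[r rX].
by exists (r *: \adj X); rewrite -scalemxAl mul_adj_mx scale_scalar_mx rX.
Qed.

(* The second hypothesis says that Tor_1(coker f0, k) = 0. *)
Lemma tor_free_regular l m n (f1 : 'M[R]_(l, m)) (f0 : 'M[R]_(m, n)) :
  f1 *m f0 = 0 ->
  (forall v : 'rV[R]_m, map_mx phi (v *m f0) = 0 ->
     (map_mx phi v <= map_mx phi f1)%MS) ->
  exists g, f0 *m g *m f0 = f0.
Proof.
move=> f10 tor0; set fb := map_mx phi f0.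
(* Rank factorization of [fb] over k: the rows of [row_base fb] are independent, so it has a right
   inverse. *)
have [B BE] : exists B, row_base fb = B *m fb.
  by apply/submxP; rewrite eq_row_base.
have [C CE] : exists C, fb = C *m row_base fb.
  by apply/submxP; rewrite eq_row_base.
have [B' B'E] := lift_mx B; have [C' C'E] := lift_mx C.
have [G GE] := lift_mx (pinvmx (row_base fb)).
(* [T] lifts [row_base fb] and keeps a right inverse; the goal becomes to factor [f0] through
   [T]. *)
set T := B' *m f0.
have TE : map_mx phi T = row_base fb by rewrite map_mxM B'E BE.
have [Z ZE] : exists Z, Z *m (T *m G) = 1%:M.
  by apply: local_invertible; rewrite map_mxM TE GE mulmxVp ?unitmx1 ?row_base_free.
have ZE' : T *m (G *m Z) = 1%:M by rewrite mulmxA; apply: mulmx1C.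
(* The rows of [1%:M - C *m B] are killed by [fb], so the Tor hypothesis applies to their lifts. *)
have [D DE] : exists D, map_mx phi (1%:M - C' *m B') = D *m map_mx phi f1.
  apply/submxP/row_subP => i; rewrite -map_row; apply: tor0.
  rewrite -row_mul map_row map_mxM map_mxB map_mx1 map_mxM B'E C'E.
  by rewrite mulmxBl mul1mx -mulmxA -BE -CE subrr row0.
have [D' D'E] := lift_mx D.
(* This matrix is the identity modulo the kernel of [phi], and its product with [f0] is [C' *m T]
   because [f1 *m f0 = 0]. *)
have [Y YE] : exists Y, Y *m (C' *m B' + D' *m f1) = 1%:M.
  apply: local_invertible; rewrite map_mxD (map_mxM _ D') D'E -DE map_mxB map_mx1.
  by rewrite addrC subrK unitmx1.
have f0E : f0 = Y *m C' *m T.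
  rewrite -[LHS]mul1mx -YE -mulmxA mulmxDl -(mulmxA D') f10 mulmx0 addr0.
  by rewrite -!mulmxA.
exists (G *m Z *m B'); rewrite -mulmxA -(mulmxA (G *m Z)) -/T [in LHS]f0E.
by rewrite -(mulmxA (Y *m C')) (mulmxA T) ZE' mul1mx -f0E.
Qed.

Variable psi : {additive R -> k}.
Hypothesis psiM : forall x y, psi (x * y) = phi x * psi y + phi y * psi x.
Variable s : R.
Hypotheses (phi_s : phi s = 0) (psi_s : psi s = 1).
Hypothesis s_ann : forall r, phi r = 0 -> s * r = 0.

Lemma syzygy_fg_ker l m n j (f2 : 'M[R]_(j, l)) (f1 : 'M[R]_(l, m))
    (f0 : 'M[R]_(m, n)) (v : 'rV[R]_m) :
  (forall x : 'rV_m, x *m f0 = 0 <-> exists y : 'rV_l, x = y *m f1) ->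
  (forall x : 'rV_l, x *m f1 = 0 <-> exists y : 'rV_j, x = y *m f2) ->
  map_mx phi (v *m f0) = 0 -> ~~ (map_mx phi v <= map_mx phi f1)%MS ->
  exists N : 'cV[R]_j, (forall i, phi (N i 0) = 0) /\
    forall r, phi r = 0 -> exists c : 'rV[R]_j, r = (c *m N) 0 0.
Proof.
move=> ex1 ex2 phiv0 vNf1.
(* A column of the cokernel matrix that does not kill v, rescaled. *)
have [c f1c vc] : exists2 c : 'cV[k]_m,
    map_mx phi f1 *m c = 0 & (map_mx phi v *m c) 0 0 = 1.
  move: vNf1; rewrite submxE => /rV0Pn[i nz].
  pose a := (map_mx phi v *m cokermx (map_mx phi f1)) 0 i.
  exists (a^-1 *: col i (cokermx (map_mx phi f1))).
    by rewrite colE -scalemxAr mulmxA mulmx_coker mul0mx scaler0.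
  by rewrite -scalemxAr mxE colE mulmxA -colE mxE mulVf.
have /ex1[y yE] : (s *: v) *m f0 = 0.
  rewrite -scalemxAl; apply/matrixP => a b; rewrite !mxE.
  by apply: s_ann; move/matrixP/(_ a b): phiv0; rewrite !mxE.
(* The Leibniz rule for matrices; the term containing [map_mx phi h *m c] vanishes. *)
have psi_via q (w : 'rV[R]_q) (h : 'M[R]_(q, m)) : map_mx phi h *m c = 0 ->
    map_mx psi (w *m h) *m c = map_mx phi w *m (map_mx psi h *m c).
  move=> hc; have -> : map_mx psi (w *m h) =
      map_mx phi w *m map_mx psi h + map_mx psi w *m map_mx phi h.
    apply/matrixP => a b; rewrite !mxE raddf_sum -big_split; apply: eq_bigr => i _.
    by rewrite !mxE psiM [phi (h i b) * _]mulrC.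
  by rewrite mulmxDl -[X in _ + X]mulmxA hc mulmx0 addr0 mulmxA.
have [t tE] := lift_mx (map_mx psi f1 *m c).
have phi_yt : phi ((y *m t) 0 0) = 1.
  have -> : phi ((y *m t) 0 0) = (map_mx phi (y *m t)) 0 0 by rewrite [RHS]mxE.
  rewrite map_mxM tE -psi_via // -yE -[RHS]vc.
  suff -> : map_mx psi (s *: v) = map_mx phi v by [].
  by apply/matrixP => a b; rewrite !mxE psiM phi_s mul0r add0r psi_s mulr1.
have [u uE] : exists u, u * (y *m t) 0 0 = 1 by apply: phi_inv; rewrite phi_yt oner_neq0.
(* The entries are the values of the form [t] on the generators of the kernel of [f1]. For r in the
   kernel of [phi], [r *: y] lies in that kernel, and [t] takes it to r times a unit. *)
exists (f2 *m t); split=> [i|r r0].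
  have -> : phi ((f2 *m t) i 0) = (map_mx phi (row i f2 *m t)) 0 0.
    by rewrite -row_mul [RHS]mxE [in RHS]mxE.
  rewrite map_mxM tE -psi_via // (_ : row i f2 *m f1 = 0).
    by rewrite map_mx0 mul0mx mxE.
  by apply/ex2; exists (delta_mx 0 i); rewrite rowE.
have /ex2[x xE] : (r *: y) *m f1 = 0.
  by rewrite -scalemxAl -yE scalerA mulrC s_ann // scale0r.
exists (u *: x); rewrite -scalemxAl mulmxA -xE -scalemxAl !mxE in uE *.
by rewrite mulrCA uE mulr1.
Qed.

Lemma ker_not_fg_3_0 :
  ~ (exists n (N : 'cV[R]_n), (forall i, phi (N i 0) = 0) /\
      forall r, phi r = 0 -> exists c : 'rV[R]_n, r = (c *m N) 0 0) ->
  nd_ring R 3 0.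
Proof.
move=> nfg E [d [f [p [p_surj [ker_p ex]]]]].
apply: projective_pd_le0.
have [g gE] : exists g, f 0 *m g *m f 0 = f 0.
  apply: (@tor_free_regular _ _ _ (f 1)).
    apply/row_matrixP => i; rewrite row_mul row0; apply/(ex 0) => //.
    by exists (delta_mx 0 i); rewrite rowE.
  (* [ex 0] and [ex 1] are exactness at F1 and F2; the latter is what 3-presented adds to
     2-presented. *)
  move=> v v0; apply/negPn/negP => vN; apply: nfg; exists (d 3).
  by apply: (syzygy_fg_ker _ _ v0 vN); [apply: (ex 0)|apply: (ex 1)].
exact: (regular_coker_projective p_surj (ker_p isT) gE).
Qed.

Lemma no_bounded_resolution (t : R) (E : lmodType R) (e : E) (d : nat) :
  phi t = 0 -> psi t = 1 -> t *: e = 0 ->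
  (exists l : {linear E -> scalars_via phi}, l e = 1) ->
  ~ pd_le E d.
Proof.
move=> phi_t psi_t te [l le] [P [g [q [projP [P0 [q_surj [ker_q ker_g]]]]]]].
have [phiL phiLE] := linear_witness (@via_linear _ _ phi).
have phiL_surj w : exists v, phiL v = w.
  by have [r rE] := phi_surj w; exists r; rewrite phiLE.
(* The multiplier [a] is [t] at stage 0 and [s] afterwards. *)
have chain i : exists (L : {linear P i -> R^o}) x x' a,
    [/\ forall y, phi (L (g i y)) = 0, phi (L x) = 1, phi a = 0, psi a = 1
      & g i x' = a *: x].
  elim: i => [|i [L [x [x' [a [Lg Lx phi_a psi_a gx']]]]]].
    have [x qx] := q_surj e.
    have [L LE] := projP 0%N _ _ phiL (l \o q) phiL_surj.
    have /ker_q[x' x'E] : q (t *: x) = 0 by rewrite linearZ /= qx.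
    exists L, x, x', t; split=> // [y|].
      rewrite -phiLE LE /=; have -> : q (g 0 y) = 0 by apply/ker_q; exists y.
      exact: linear0.
    by rewrite -phiLE LE /= qx.
  (* Linearity: in the Leibniz expansion of psi(b L(g y)), the term with phi(L(g y)) is 0. *)
  have [M ME] : exists M : {linear P i.+1 -> scalars_via phi},
      M =1 (fun y => psi (L (g i y))).
    apply: linear_witness => b y z; rewrite !linearP raddfD psiM Lg mul0r addr0.
    by [].
  have [L' L'E] := projP i.+1 _ _ phiL M phiL_surj.
  have L'x : phi (L' x') = 1.
    rewrite -phiLE L'E ME gx' linearZ psiM phi_a mul0r add0r Lx mul1r.
    exact: psi_a.
  (* [s * a = 0] since [phi a = 0], so [s *: x'] is a cycle. *)
  have /ker_g[x'' x''E] : g i (s *: x') = 0.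
    by rewrite linearZ /= gx' scalerA s_ann // scale0r.
  exists L', x', x'', s; split=> // y.
  rewrite -phiLE L'E ME (_ : g i _ = 0) ?linear0 ?raddf0 //.
  by apply/ker_g; exists y.
have [L [x [_ [_ [_ Lx _ _ _]]]]] := chain d.+1.
by move/eqP: Lx; rewrite (P0 d.+1 _ x) // linear0 rmorph0 eq_sym oner_eq0.
Qed.

End ResidueField.

(** * Cyclic modules R/Rm *)

Lemma ideal_pi_eq0 (R : comNzRingType) (I : idealr R) (a : R) :
  (\pi_{ideal_quot I} a == 0) = (a \in (I : pred R)).
Proof. by rewrite piE Quotient.equivE subr0. Qed.

(** An [idealr] is a proper ideal, so m must not be a unit; membership is made boolean
    classically. *)
Lemma principal_quotient (R : comNzRingType) (m : R) :
  (forall r, r * m <> 1) ->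
  exists (S : comNzRingType) (pi : {rmorphism R -> S}),
    (forall x, exists r, pi r = x) /\
    forall a, pi a = 0 <-> exists r, a = r * m.
Proof.
move=> m_nonunit; pose I : R -> bool := fun x => `[< exists r, x = r * m >].
have I_closed : idealr_closed I.
  split; rewrite ?unfold_in /I.
  - by apply/asboolP; exists 0; rewrite mul0r.
  - by apply/negP => /asboolP[r /esym]; apply: m_nonunit.
  - move=> a u v /asboolP[r ->] /asboolP[r' ->]; apply/asboolP.
    by exists (a * r + r'); rewrite mulrDl mulrA.
pose J : idealr R := HB.pack I (isIdealr.Build R I I_closed).
exists {ideal_quot J}, (\pi_{ideal_quot J}); split=> [x|a].
  by exists (repr x); apply: reprK.
split=> [/eqP|aI].
  by rewrite ideal_pi_eq0 => /asboolP.
by apply/eqP; rewrite ideal_pi_eq0; apply/asboolP.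
Qed.

(** As s generates the annihilator of m, R --s--> R --m--> R is the start of a resolution of
    R/Rm. *)
Lemma principal_quotient_2_presented (R S : comNzRingType) (m s : R)
    (pi : {rmorphism R -> S}) :
  (forall r, r * m = 0 <-> exists c, r = c * s) ->
  (forall x, exists r, pi r = x) ->
  (forall a, pi a = 0 <-> exists r, a = r * m) ->
  n_presented (scalars_via pi) 2.
Proof.
move=> m_ann pi_surj pi_ker.
have [p pE] : exists p : {linear 'rV[R]_1 -> scalars_via pi}, p =1 (fun x => pi (x 0 0)).
  by apply: linear_witness => a x y; rewrite !mxE rmorphD rmorphM.
have mulE (x : 'rV[R]_1) a b : (x == b *m a%:M) = (x 0 0 == b 0 0 * a).
  rewrite mul_mx_scalar; apply/eqP/eqP => [->|xE]; first by rewrite mxE mulrC.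
  by apply/rowP => i; rewrite !ord1 mxE mulrC.
exists (fun=> 1%N), (fun i => if i is 0 then m%:M else s%:M), p; split=> [e|].
  by have [r <-] := pi_surj e; exists r%:M; rewrite pE mxE.
split=> [_ x|[|i] // _ x].
  rewrite pE; split=> [/pi_ker[r xE]|[y ->]].
    by exists r%:M; apply/eqP; rewrite mulE mxE xE.
  by apply/pi_ker; exists (y 0 0); rewrite mul_mx_scalar mxE mulrC.
have -> : (x *m m%:M = 0) <-> x 0 0 * m = 0.
  split=> [/rowP/(_ 0)|x0]; first by rewrite mul_mx_scalar !mxE mulrC.
  by apply/rowP => j; rewrite ord1 mul_mx_scalar !mxE mulrC.
split=> [/m_ann[c xE]|[y ->]].
  by exists c%:M; apply/eqP; rewrite mulE mxE xE.
by apply/m_ann; exists (y 0 0); rewrite mul_mx_scalar mxE mulrC.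
Qed.

(** * The residue field of A and the trivial extension R *)

Section ResidueIsField.
Variable A : localRingType.

Lemma residue_pi_eq0 (a : A) :
  (\pi_(residue A) a == 0) = (a \isn't a GRing.unit).
Proof. exact: ideal_pi_eq0. Qed.

(* An alias, so that the field structure does not interfere with the instances
   of [residue A]. *)
Definition residue_field : Type := residue A.
HB.instance Definition _ := GRing.ComNzRing.on residue_field.

Definition residue_inv (x : residue_field) : residue_field :=
  \pi_(residue A) (repr (x : residue A))^-1.

Lemma residue_mulVf (x : residue_field) : x != 0 -> residue_inv x * x = 1.
Proof.
move=> x0; have ux : repr (x : residue A) \is a GRing.unit.
  by apply: contraNT x0; rewrite -residue_pi_eq0 reprK.
have -> : residue_inv x * x =
    \pi_(residue A) ((repr (x : residue A))^-1 * repr (x : residue A)).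
  by rewrite rmorphM /= reprK.
by rewrite mulVr // rmorph1.
Qed.

(** The inverse of a nonunit of A is itself by convention, so the representative of 0 is sent back
    to 0. *)
Lemma residue_inv0 : residue_inv 0 = 0.
Proof.
have nu : repr (0 : residue A) \isn't a GRing.unit.
  by rewrite -residue_pi_eq0 reprK.
by rewrite /residue_inv invr_out // reprK.
Qed.

HB.instance Definition _ :=
  GRing.ComNzRing_isField.Build residue_field residue_mulVf residue_inv0.

Local Notation R := (triv_ext A (residue A)).

(** [triv_res] and [triv_snd] are the maps phi and psi for R. *)
Definition triv_res (x : R) : residue_field := \pi_(residue A) x.1.
Definition triv_snd (x : R) : residue_field := x.2.

Lemma triv_res_additive : zmod_morphism triv_res.
Proof. by move=> x y; rewrite /triv_res raddfB. Qed.
Lemma triv_res_monoid : monoid_morphism triv_res.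
Proof.
split=> [|x y]; first exact: (rmorph1 (\pi_(residue A))).
exact: (rmorphM (\pi_(residue A))).
Qed.

HB.instance Definition _ :=
  GRing.isZmodMorphism.Build R residue_field triv_res triv_res_additive.
HB.instance Definition _ :=
  GRing.isMonoidMorphism.Build R residue_field triv_res triv_res_monoid.

Lemma triv_snd_additive : zmod_morphism triv_snd.
Proof. by []. Qed.
HB.instance Definition _ :=
  GRing.isZmodMorphism.Build R residue_field triv_snd triv_snd_additive.

Lemma triv_snd_derivation x y :
  triv_snd (x * y) = triv_res x * triv_snd y + triv_res y * triv_snd x.
Proof. by []. Qed.

Lemma triv_res_surj x : exists r, triv_res r = x.
Proof. by exists (repr (x : residue A), 0); rewrite /triv_res /= reprK. Qed.

Lemma triv_res_inv r : triv_res r != 0 -> exists r', r' * r = 1.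
Proof.
rewrite /triv_res residue_pi_eq0 negbK; case: r => a e /= ua.
exists (a^-1, - (a^-1 * a^-1) *: e); rewrite -[LHS]/(triv_mul _ _) /triv_mul /=.
by rewrite mulVr // scaleNr scalerN scalerA mulrA divrr // mul1r subrr.
Qed.

Lemma triv_res_ann r : triv_res r = 0 -> ((0, 1) : R) * r = 0.
Proof.
move=> r0; rewrite -[LHS]/(triv_mul _ _) /triv_mul /= mul0r scale0r add0r.
by congr (_, _); rewrite -[LHS]/(triv_res r * 1) r0 mul0r.
Qed.

End ResidueIsField.

(* R = A ∝ A/M, with A local with maximal ideal M = maxideal A. *)
Theorem theorem1p1 (A : localRingType) :
  (~ fg_ideal (maxideal A) -> nd_ring (triv_ext A (residue A)) 3 0) /\
  ((exists m : A, m \in maxideal A /\ regular m) ->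
     forall d : nat, ~ nd_ring (triv_ext A (residue A)) 2 d).
Proof.
pose s : triv_ext A (residue A) := (0, 1).
have s0 : triv_res s = 0 by rewrite /triv_res raddf0.
split=> [nfg|[m [mM m_reg]] d nd].
  apply: (ker_not_fg_3_0 (@triv_res_surj A) (@triv_res_inv A)
    (@triv_snd_derivation A) s0 (erefl : triv_snd s = 1) (@triv_res_ann A)).
  (* The first coordinates of generators of the maximal ideal of R generate M. *)
  move=> [n [N [N0 N_gen]]]; apply: nfg; exists n, (fun i => (N i 0).1) => x.
  have sum1 (F : 'I_n -> triv_ext A (residue A)) : (\sum_i F i).1 = \sum_i (F i).1.
    by apply: (big_morph fst).
  split=> [xM|[c ->]].
    have /N_gen[c cE] : triv_res ((x, 0) : triv_ext A (residue A)) = 0.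
      by apply/eqP; rewrite /triv_res residue_pi_eq0.
    exists (fun i => (c 0 i).1).
    by move/(congr1 fst): cE; rewrite mxE sum1.
  have: triv_res (\sum_i ((c i, 0) : triv_ext A (residue A)) * N i 0) = 0.
    by rewrite raddf_sum big1 // => i _; rewrite [LHS]rmorphM /= N0 mulr0.
  by move/eqP; rewrite /triv_res residue_pi_eq0 sum1.
pose t : triv_ext A (residue A) := (m, 1).
have t0 : triv_res t = 0 by apply/eqP; rewrite /triv_res residue_pi_eq0.
have t_ann r : r * t = 0 <-> exists c, r = c * s.
  split=> [rt0|[c ->]]; last by rewrite -mulrA (triv_res_ann t0) mulr0.
  (* The first coordinate of [r * t] is [r.1 * m], so regularity of m leaves r = (0, [r.2]), a
     multiple of [s] by any lift of [r.2]. *)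
  have r1 : r.1 = 0 by apply: m_reg; rewrite mulrC; case: rt0.
  exists (repr r.2, 0); rewrite -[RHS]/(triv_mul _ _) /triv_mul /=.
  rewrite mulr0 scaler0 addr0 -r1 [repr _ *: _](_ : _ = r.2); first by case: (r).
  by rewrite -[LHS]/(\pi_(residue A) _ * 1) reprK mulr1.
have t_nonunit r : r * t <> 1.
  move/(congr1 (@triv_res A)); rewrite rmorphM /= t0 mulr0 rmorph1 => /esym/eqP.
  by rewrite oner_eq0.
have [S [pi [pi_surj pi_ker]]] := principal_quotient t_nonunit.
have E2 := principal_quotient_2_presented t_ann pi_surj pi_ker.
(* The residue map kills [t], so it factors through R/Rt, sending the class of 1 to 1. *)
have [r /pi_ker[c ->]|l lE] := via_factor (phi := @triv_res A) pi_surj.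
  by rewrite rmorphM /= t0 mulr0.
have t1 : t *: (pi 1 : scalars_via pi) = 0.
  by rewrite via_scaleE -rmorphM mulr1; apply/pi_ker; exists 1; rewrite mul1r.
have l1 : exists l : {linear scalars_via pi -> scalars_via (@triv_res A)}, l (pi 1) = 1.
  by exists l; rewrite lE rmorph1.
exact: (no_bounded_resolution (@triv_res_surj A)
  (@triv_snd_derivation A) s0 (erefl : triv_snd s = 1) (@triv_res_ann A)
  t0 (erefl : triv_snd t = 1) t1 l1 (nd _ E2)).
Qed.
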